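(* For all integers $w\in\mathbb Z$ and $u,\ell\in\mathbb Z_{\ge0}$ with $u,\ell$ not both $0$, one has $T(w,u,\ell)=0$, where $$\begin{aligned}T(w,u,\ell)=&\sum_{\substack{c,e,r\ge0\\c+e+r=u}}\ \sum_{\substack{t=0\\2\mid(t+w-r)}}^{\ell}q^{-t(\ell+u-1)+(\ell+u)(c-e)}\begin{bmatrix}\ell\\t\end{bmatrix}_q\begin{bmatrix}w+t-\ell\\ r\end{bmatrix}_q\begin{bmatrix}u-1+\frac{w+t-r}2\\c\end{bmatrix}_{q^2}\begin{bmatrix}\frac{w+t-r}2-\ell\\ e\end{bmatrix}_{q^2}\\&-\sum_{\substack{c,e,r\ge0\\c+e+r=u}}\ \sum_{\substack{t=0\\2\nmid(t+w-r)}}^{\ell}q^{-t(\ell+u-1)+(\ell+u-1)(c-e)}\begin{bmatrix}\ell\\t\end{bmatrix}_q\begin{bmatrix}w+t-\ell\\ r\end{bmatrix}_q\begin{bmatrix}u+\frac{w+t-r-1}2\\c\end{bmatrix}_{q^2}\begin{bmatrix}\frac{w+t-r-1}2-\ell\\ e\end{bmatrix}_{q^2}.\end{aligned}$$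
   Context: $q$ is an indeterminate. For $n,d\in\mathbb Z$: $[n]=[n]_q=\frac{q^n-q^{-n}}{q-q^{-1}}$, $[m]!=[1][2]\cdots[m]$ for $m\ge 0$, and $\begin{bmatrix}n\\d\end{bmatrix}_q=\frac{[n][n-1]\cdots[n-d+1]}{[d]!}$ if $d\ge0$, and $0$ if $d<0$ ($n$ may be negative). $\begin{bmatrix}n\\d\end{bmatrix}_{q^2}$ is obtained by replacing $q$ by $q^2$. *)

(* Defs.v *)
From HB Require Import structures.
From mathcomp Require Import all_boot all_order all_algebra.

Set Implicit Arguments.
Unset Strict Implicit.
Unset Printing Implicit Defensive.

Import GRing.Theory.
Local Open Scope ring_scope.

(* The base field is Q(q), realized as the fraction field of Q['X]. *)
Definition Qq : fieldType := {fraction {poly rat}}.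

Definition q : Qq := @FracField.tofrac {poly rat} 'X.

(* The parameter [x] is the quantum parameter: it is instantiated by [q] and
   by [q ^+ 2]. The exponent in [x ^ n] is an integer. *)
Definition qint (x : Qq) (n : int) : Qq := (x ^ n - x ^ (- n)) / (x - x^-1).

Definition qfact (x : Qq) (m : nat) : Qq := \prod_(1 <= i < m.+1) qint x i%:Z.

Definition qbinom (x : Qq) (n d : int) : Qq :=
  match d with
  | Posz k => (\prod_(0 <= i < k) qint x (n - i%:Z)) / qfact x k
  | Negz _ => 0
  end.

(* In both sums the division by 2 is exact, because of the parity condition on
   [t]. All the indices are bounded by construction: [c + e + r = u] forces
   [c, e, r <= u]. *)
Definition Teven (w : int) (u l : nat) : Qq :=
  \sum_(c < u.+1) \sum_(e < u.+1) \sum_(r < u.+1 | (c + e + r == u)%N)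
   \sum_(t < l.+1 | (2 %| t%:Z + w - r%:Z)%Z)
     q ^ (- t%:Z * (l%:Z + u%:Z - 1) + (l%:Z + u%:Z) * (c%:Z - e%:Z))
     * qbinom q l%:Z t%:Z
     * qbinom q (w + t%:Z - l%:Z) r%:Z
     * qbinom (q ^+ 2) (u%:Z - 1 + ((w + t%:Z - r%:Z) %/ 2)%Z) c%:Z
     * qbinom (q ^+ 2) (((w + t%:Z - r%:Z) %/ 2)%Z - l%:Z) e%:Z.

Definition Todd (w : int) (u l : nat) : Qq :=
  \sum_(c < u.+1) \sum_(e < u.+1) \sum_(r < u.+1 | (c + e + r == u)%N)
   \sum_(t < l.+1 | ~~ (2 %| t%:Z + w - r%:Z)%Z)
     q ^ (- t%:Z * (l%:Z + u%:Z - 1) + (l%:Z + u%:Z - 1) * (c%:Z - e%:Z))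
     * qbinom q l%:Z t%:Z
     * qbinom q (w + t%:Z - l%:Z) r%:Z
     * qbinom (q ^+ 2) (u%:Z + ((w + t%:Z - r%:Z - 1) %/ 2)%Z) c%:Z
     * qbinom (q ^+ 2) (((w + t%:Z - r%:Z - 1) %/ 2)%Z - l%:Z) e%:Z.

Definition T (w : int) (u l : nat) : Qq := Teven w u l - Todd w u l.

(* Main.v *)
Require Import Defs.
From mathcomp Require Import all_boot all_order all_algebra.
From mathcomp Require Import ring zify.

(* Put b = l + u and s = w + t - r. In generating functions, the sum over c and
   e with c + e = u - r is the coefficient of a product of two Gauss products
   with ratio q^4, whose factors interleave at their lower ends. By
   q-Vandermonde this product equals
     (s - 2 l - 1 consecutive factors of ratio q^2, centered at q^(-b))
     * (b factors of ratio q^4, centered at q^(s - 2 l + b - 2)),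
   in the same form for both parities of s; the parity only contributes the
   sign (-1)^s. Since [s-2l-1; c] = (-1)^c [2l+c+r-w-t; c], the sum over r is
   again a q-Vandermonde sum, and it depends on t only through q^(t u). What
   remains is the sum over t of (-1)^t q^(-t (l - 1)) [l; t], which vanishes for
   l > 0; for l = 0 the same alternating sum, in base q^2, appears over e. *)

Set Implicit Arguments.
Unset Strict Implicit.
Unset Printing Implicit Defensive.

Import GRing.Theory.
Local Open Scope ring_scope.

(** * Gauss binomials with an integer upper entry *)

Section QBinomial.

Variable F : fieldType.
Implicit Types (n m p : int) (k : nat).

(* These repeat qint, qfact and qbinom over an abstract field: conversion in
   the concrete fraction field Qq is prohibitively slow. *)
Definition qnum (x : F) n : F := (x ^ n - x ^ (- n)) / (x - x^-1).

Definition qnum_fact (x : F) k : F := \prod_(1 <= i < k.+1) qnum x i%:Z.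

Definition qbin (x : F) n k : F :=
  (\prod_(0 <= i < k) qnum x (n - i%:Z)) / qnum_fact x k.

Lemma qnumV (x : F) n : qnum x^-1 n = qnum x n.
Proof.
rewrite /qnum !exprz_inv !opprK invrK.
by rewrite -opprB -(opprB x) invrN mulrNN.
Qed.

Lemma qbinV (x : F) n k : qbin x^-1 n k = qbin x n k.
Proof.
rewrite /qbin /qnum_fact; congr (_ / _); apply: eq_bigr => i _; exact: qnumV.
Qed.

Lemma qnumN (x : F) n : qnum x (- n) = - qnum x n.
Proof. by rewrite /qnum opprK -mulNr opprB. Qed.

Lemma qbin0 (x : F) n : qbin x n 0 = 1.
Proof. by rewrite /qbin /qnum_fact !big_geq ?divr1. Qed.

Lemma qbinS (x : F) n k :
  qbin x n k.+1 = qbin x n k * (qnum x (n - k%:Z) / qnum x k.+1%:Z).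
Proof.
rewrite /qbin /qnum_fact big_nat_recr //= [in X in _ / X]big_nat_recr //=.
by rewrite invfM mulrACA.
Qed.

Lemma qbinSl (x : F) n k :
  qbin x (n + 1) k.+1 = qbin x n k * (qnum x (n + 1) / qnum x k.+1%:Z).
Proof.
rewrite /qbin /qnum_fact big_nat_recl //= [in X in _ / X]big_nat_recr //=.
rewrite subr0 invfM.
under eq_bigr => i _ do rewrite intS opprD addrA addrK.
by rewrite (mulrC (qnum x (n + 1))) mulrACA.
Qed.

Lemma qbin_small (x : F) j k : (j < k)%N -> qbin x j%:Z k = 0.
Proof.
elim: k => // k IHk; rewrite ltnS leq_eqVlt qbinS => /predU1P[->|/IHk->].
  by rewrite subrr /qnum oppr0 subrr !mul0r mulr0.
by rewrite mul0r.
Qed.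

(** Reversing the order of the numerator factors and changing the sign of each gives this
    reflection, which later moves the summation index out of an upper entry. *)
Lemma qbinN (x : F) n k :
  qbin x n k = (-1) ^+ k * qbin x (k%:Z - 1 - n) k.
Proof.
rewrite /qbin mulrA; congr (_ / _).
rewrite [X in _ = _ * X]big_nat_rev /= add0n.
rewrite -[in (-1) ^+ k](subn0 k) -prodr_const_nat -big_split /=.
apply: eq_big_nat => i /andP[_ i_lt]; rewrite mulN1r -qnumN.
by congr qnum; lia.
Qed.

(** For nonzero [x], this keeps [qnum x i] nonzero for [i > 0], as its zeros are roots of unity. *)
Definition not_root1 (x : F) := forall i, (0 < i)%N -> x ^+ i != 1.

Lemma not_root1V (x : F) : not_root1 x -> not_root1 x^-1.
Proof. by move=> xP i /xP; rewrite exprVn invr_eq1. Qed.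

Section Pascal.

Variable x : F.
Hypotheses (x_neq0 : x != 0) (xP : not_root1 x).

Lemma subV_neq0 : x - x^-1 != 0.
Proof.
rewrite subr_eq0; apply: contra (xP (isT : 0 < 2)%N) => /eqP xV.
by rewrite expr2 {2}xV divff.
Qed.

Lemma qnum_nat_neq0 i : (0 < i)%N -> qnum x i%:Z != 0.
Proof.
move=> i_gt0; rewrite /qnum mulf_neq0 ?invr_eq0 ?subV_neq0 // subr_eq0.
apply: contra (xP (i := i + i) _); last by rewrite addn_gt0 i_gt0.
by move=> /eqP xi; rewrite exprnP PoszD expfzDr // {1}xi -expfzDr // addNr.
Qed.

Lemma qbin_pascal n k :
  qbin x (n + 1) k.+1 =
  x ^ (- k.+1%:Z) * qbin x n k.+1 + x ^ (n - k%:Z) * qbin x n k.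
Proof.
rewrite qbinSl qbinS.
have nz := qnum_nat_neq0 (ltn0Sn k).
suff -> : qnum x (n + 1) = x ^ (- k.+1%:Z) * qnum x (n - k%:Z)
                         + x ^ (n - k%:Z) * qnum x k.+1%:Z.
  by field.
rewrite /qnum !mulrA -mulrDl !mulrBr -!expfzDr //; congr (_ / _).
have -> : n - k%:Z + k.+1%:Z = n + 1 by lia.
have -> : - k.+1%:Z + (n - k%:Z) = n - k%:Z - k.+1%:Z by lia.
have -> : - k.+1%:Z - (n - k%:Z) = - (n + 1) by lia.
by ring.
Qed.

Lemma qbin_nn k : qbin x k%:Z k = 1.
Proof.
elim: k => [|k IHk]; first exact: qbin0.
rewrite -[X in qbin _ (Posz X) _]addn1 PoszD qbin_pascal.
by rewrite qbin_small // IHk subrr expr0z !mul1r mulr0 add0r.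
Qed.

(** Pascal's rule makes the sum telescope: the partial sum up to [j] is (-1)^j x^(-j l) [l-1; j],
    which vanishes at [j = l]. *)
Lemma alternating_qbin_sum l : (0 < l)%N ->
  \sum_(t < l.+1) (-1) ^+ t * x ^ (- t%:Z * (l%:Z - 1)) * qbin x l%:Z t = 0.
Proof.
case: l => // l _.
suff partial j :
    \sum_(t < j.+1) (-1) ^+ t * x ^ (- t%:Z * (l.+1%:Z - 1)) * qbin x l.+1%:Z t
  = (-1) ^+ j * x ^ (- j%:Z * l.+1%:Z) * qbin x l%:Z j.
  by rewrite partial qbin_small ?mulr0.
elim: j => [|j IHj].
  by rewrite big_ord1 !qbin0 !oppr0 !mul0r.
rewrite big_ord_recr /= IHj.
rewrite -[X in _ * qbin _ (Posz X) j.+1]addn1 PoszD qbin_pascal mulrDr !mulrA.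
rewrite -!(mulrA (_ ^+ _)) -!expfzDr //.
have -> : - j.+1%:Z * (l.+1%:Z - 1) - j.+1%:Z = - j.+1%:Z * l.+1%:Z by lia.
have -> : - j.+1%:Z * (l.+1%:Z - 1) + (l%:Z - j%:Z) = - j%:Z * l.+1%:Z by lia.
by rewrite exprS; ring.
Qed.

End Pascal.

End QBinomial.

(** * Power series modulo X^N, represented by polynomials *)

Section Truncation.

Variables (F : fieldType) (N : nat).
Implicit Types f g h : {poly F}.

Definition eqmodXn f g := forall i, (i < N)%N -> f`_i = g`_i.

Lemma eqmodXn_sym f g : eqmodXn f g -> eqmodXn g f.
Proof. by move=> fg i /fg. Qed.

Lemma eqmodXn_trans f g h : eqmodXn f g -> eqmodXn g h -> eqmodXn f h.
Proof. by move=> fg gh i iN; rewrite fg // gh. Qed.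

Lemma eqmodXnM f f' g g' :
  eqmodXn f f' -> eqmodXn g g' -> eqmodXn (f * g) (f' * g').
Proof.
move=> ff' gg' i iN; rewrite !coefM; apply: eq_bigr => j _.
by rewrite ff' ?gg' //; [apply: leq_ltn_trans iN; rewrite leq_subr
  | apply: leq_ltn_trans iN; rewrite -ltnS].
Qed.

Lemma eqmodXn_cancel h f g :
  h`_0 = 1 -> eqmodXn (f * h) (g * h) -> eqmodXn f g.
Proof.
move=> h0 fgh i; elim/ltn_ind: i => i IHi iN.
have := fgh i iN; rewrite !coefM !big_ord_recr /= subnn h0 !mulr1.
rewrite (eq_bigr (fun j : 'I_i => g`_j * h`_(i - j))); first exact: addrI.
by move=> j _; rewrite IHi // (ltn_trans _ iN).
Qed.

(** A factor with constant term 1 is invertible as a power series, so it can be inserted or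
    cancelled. The equivalence feeds inductions over all integers, where the downward step is a
    cancellation. *)
Lemma eqmodXn_step h f f' g g' : h`_0 = 1 ->
  eqmodXn f' (f * h) -> eqmodXn g' (g * h) -> eqmodXn f g <-> eqmodXn f' g'.
Proof.
move=> h0 ff' gg'; split=> fg.
  apply: eqmodXn_trans ff' _; apply: eqmodXn_trans (eqmodXn_sym gg').
  exact: eqmodXnM.
apply: (eqmodXn_cancel h0); apply: eqmodXn_trans (eqmodXn_sym ff') _.
exact: eqmodXn_trans fg gg'.
Qed.

End Truncation.

Lemma int_ind_iff (P : int -> Prop) :
  P 0 -> (forall n, P n <-> P (n + 1)) -> forall n, P n.
Proof.
move=> P0 PS; elim/int_rect => [//|n IHn|n IHn].
  by have /PS := IHn; congr P; lia.
by apply/PS; move: IHn; congr P; lia.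
Qed.

(** * Gauss products as truncated series *)

Section QSeries.

Variables (F : fieldType) (N : nat).
Implicit Types (x z : F) (n m p : int) (k : nat).

Local Notation "f =N g" := (eqmodXn N f g) (at level 70).
Local Notation lin c := (1 + c *: 'X).

(* Truncation of the product over j < n of 1 + z x^(n - 1 - 2 j) 'X, which is a
   power series when n < 0. *)
Definition qser x n z : {poly F} := \poly_(k < N) (qbin x n k * z ^+ k).

Lemma qserV x n z : qser x^-1 n z = qser x n z.
Proof. by apply/polyP => i; rewrite !coef_poly qbinV. Qed.

Lemma qser0 x z : qser x 0 z =N 1.
Proof.
move=> i iN; rewrite coef_poly iN coef1; case: i {iN} => [|i].
  by rewrite qbin0 mulr1.
by rewrite (@qbin_small _ _ 0) // mul0r.
Qed.

Lemma coef0_lin c : (lin c : {poly F})`_0 = 1.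
Proof. by rewrite coefD coefZ coefX coef1 mulr0 addr0. Qed.

Section Recurrences.

Variable x : F.
Hypotheses (x_neq0 : x != 0) (xP : not_root1 x).

(** Pascal's rule read coefficientwise: the top factor [j = 0] splits off, and [z / x] recenters the
    others. *)
Lemma qser_up n z : qser x (n + 1) z =N qser x n (z / x) * lin (z * x ^ n).
Proof.
move=> i iN; rewrite mulrDr mulr1 -scalerAr coefD coefZ coefMX.
rewrite !coef_poly iN; case: i iN => [|i] iN /=.
  by rewrite !qbin0 mulr0 addr0.
rewrite (ltnW iN) qbin_pascal // expfzDr // -!exprnN !expr_div_n !exprS.
by field; rewrite x_neq0 expf_neq0.
Qed.

End Recurrences.

Section Vandermonde.

Variable x : F.
Hypotheses (x_neq0 : x != 0) (xP : not_root1 x).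

(** The symmetry between [x] and [x^-1] turns the splitting of the top factor into that of the
    bottom one. *)
Lemma qser_down n z :
  qser x (n + 1) z =N qser x n (z * x) * lin (z * x ^ (- n)).
Proof.
have xV0 : x^-1 != 0 by rewrite invr_eq0.
by have := qser_up xV0 (not_root1V xP) n z; rewrite !qserV invrK exprz_inv.
Qed.

(** For natural [m] and [p] this cuts the product into its top [m] and bottom [p] factors. Induction
    on [p] extends it to all integers, one bottom factor at a time. *)
Lemma qser_vandermonde m p z :
  qser x (m + p) z =N qser x m (z * x ^ p) * qser x p (z * x ^ (- m)).
Proof.
elim/int_ind_iff: p z => [z|p].
  rewrite addr0 expr0z mulr1 -[X in eqmodXn _ X]mulr1.
  by apply: eqmodXnM => //; apply: eqmodXn_sym; apply: qser0.
have step z := eqmodXn_step (coef0_lin (z * x ^ (- (m + p))))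
  (f' := qser x (m + (p + 1)) z) (f := qser x (m + p) (z * x))
  (g' := qser x m (z * x ^ (p + 1)) * qser x (p + 1) (z * x ^ (- m)))
  (g := qser x m (z * x * x ^ p) * qser x p (z * x * x ^ (- m))) (N := N).
have {}step z : qser x (m + p) (z * x) =N
    qser x m (z * x * x ^ p) * qser x p (z * x * x ^ (- m)) <->
  qser x (m + (p + 1)) z =N
    qser x m (z * x ^ (p + 1)) * qser x (p + 1) (z * x ^ (- m)).
  apply: step; first by rewrite addrA; apply: qser_down.
  rewrite -mulrA; have -> : z * x ^ (p + 1) = z * x * x ^ p.
    by rewrite expfzDr // expr1z; ring.
  apply: eqmodXnM => //; apply: eqmodXn_trans (qser_down _ _) _.
  by rewrite mulrAC opprD expfzDr // mulrA.
split=> IH z; first by apply/step.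
(* One step links center [z * x] to center [z], so the downward direction starts from [z / x]. *)
by have /step := IH (z / x); rewrite divfK.
Qed.

Lemma sqr_neq0 : x ^+ 2 != 0.
Proof. exact: expf_neq0. Qed.

Lemma not_root1_sqr : not_root1 (x ^+ 2).
Proof. by move=> i i_gt0; rewrite -exprM xP // muln_gt0. Qed.

Lemma sqr_exprz n : (x ^+ 2) ^ n = x ^ (2 * n).
Proof. by rewrite exprnP exprz_exp. Qed.

End Vandermonde.

Section Doubling.

Variable x : F.
Hypotheses (x_neq0 : x != 0) (xP : not_root1 x).

Let x2_neq0 := sqr_neq0 x_neq0.
Let x2P := not_root1_sqr xP.

(** Two products of ratio x^4 whose centers differ by x^2 interleave into one of ratio x^2. *)
Lemma qser_double a z : qser (x ^+ 2) a (z * x) * qser (x ^+ 2) a (z / x) =N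
  qser x (2 * a) z.
Proof.
elim/int_ind_iff: a z => [z|a].
  rewrite mulr0; apply: eqmodXn_trans (eqmodXn_sym (qser0 _ _)).
  by rewrite -[X in eqmodXn _ _ X]mulr1; apply: eqmodXnM; apply: qser0.
suff step z :
  qser (x ^+ 2) a (z * x) * qser (x ^+ 2) a (z / x) =N qser x (2 * a) z <->
  qser (x ^+ 2) (a + 1) (z * x) * qser (x ^+ 2) (a + 1) (z / x) =N
  qser x (2 * (a + 1)) z by split=> IH z; apply/step.
apply: (@eqmodXn_step _ _
  (lin (z * x ^ (2 * a + 1)) * lin (z / x * x ^ (- (2 * a))))).
- by rewrite coefM big_ord1 !coef0_lin mulr1.
(* Removing the top factor of the first product moves its center from [z * x] to [z / x]; removing
   the bottom factor of the second does the opposite. The two products thus trade places. *)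
- rewrite [qser _ a _ * _]mulrC mulrACA.
  apply: eqmodXnM; apply: eqmodXn_trans.
  + exact: qser_up.
  + rewrite sqr_exprz // expfzDr // expr1z.
    have -> : z * x / x ^+ 2 = z / x by field.
    by rewrite (mulrC (x ^ _)) mulrA.
  + exact: qser_down.
  + rewrite sqr_exprz // mulrN.
    by have -> : z / x * x ^+ 2 = z * x by field.
- have -> : 2 * (a + 1) = 2 * a + 1 + 1 by lia.
  apply: eqmodXn_trans (qser_up _ _ _ _) _ => //.
  rewrite [lin _ * lin _]mulrC mulrA; apply: eqmodXnM => //.
  apply: eqmodXn_trans (qser_down _ _ _ _) _ => //.
  by rewrite divfK.
Qed.

(** This is [qser_double] at center [z * x] with the common top factor cancelled. *)
Lemma qser_double_pred a z : qser (x ^+ 2) (a - 1) z * qser (x ^+ 2) a z =N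
  qser x (2 * a - 1) z.
Proof.
apply/(@eqmodXn_step _ _ (lin (z * x * x ^ (2 * a - 1))) _
  (qser (x ^+ 2) a (z * x * x) * qser (x ^+ 2) a (z * x / x)) _
  (qser x (2 * a) (z * x))).
- exact: coef0_lin.
- rewrite mulfK // [_ * lin _]mulrAC; apply: eqmodXnM => //.
  have {1}-> : a = a - 1 + 1 by lia.
  apply: eqmodXn_trans (qser_up _ _ _ _) _ => //.
  have -> : z * x * x / x ^+ 2 = z by field.
  rewrite sqr_exprz //.
  have -> : z * x * x * x ^ (2 * (a - 1)) = z * x * x ^ (2 * a - 1) => //.
  have -> : 2 * a - 1 = 2 * (a - 1) + 1 by lia.
  by rewrite expfzDr // expr1z; ring.
- have {1}-> : 2 * a = 2 * a - 1 + 1 by lia.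
  by apply: eqmodXn_trans (qser_up _ _ _ _) _ => //; rewrite mulfK.
- exact: qser_double.
Qed.

End Doubling.
End QSeries.

(** * Reindexing of sums over triangles and simplices *)

Lemma exchange_big_triangle (V : nmodType) u (f : nat -> nat -> V) :
  \sum_(i < u.+1) \sum_(j < (u - i).+1) f i j =
  \sum_(j < u.+1) \sum_(i < (u - j).+1) f i j.
Proof.
under eq_bigr => i _ do
  rewrite (big_ord_widen u.+1 (f i)) ?ltnS ?leq_subr //.
rewrite (exchange_big_dep xpredT) //=; apply: eq_bigr => j _.
rewrite (big_ord_widen u.+1 (f^~ j)) ?ltnS ?leq_subr //.
by apply: eq_bigl => i; have := ltn_ord i; have := ltn_ord j; lia.
Qed.

Lemma big_simplex (V : nmodType) u (f : nat -> nat -> nat -> V) :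
  \sum_(c < u.+1) \sum_(e < u.+1) \sum_(r < u.+1 | (c + e + r == u)%N) f c e r =
  \sum_(r < u.+1) \sum_(c < (u - r).+1) f c (u - r - c)%N r.
Proof.
under eq_bigr => c _ do rewrite (exchange_big_dep xpredT) //=.
rewrite exchange_big /=; apply: eq_bigr => r _.
rewrite (big_ord_widen u.+1 (fun c => f c (u - r - c)%N r)) ?ltnS ?leq_subr //.
rewrite [RHS]big_mkcond; apply: eq_bigr => c _.
have := ltn_ord r; have := ltn_ord c => cu ru.
case: ifPn => cr; last by rewrite big_pred0 // => e; lia.
rewrite (big_pred1 (inord (u - r - c))) ?inordK //; first by lia.
by move=> e /=; rewrite -val_eqE /= inordK; lia.
Qed.

(** * Summation over [c] and [e], then [r], then [t] *)

Section MainIdentity.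

Variables (F : fieldType) (x : F).
Hypotheses (x_neq0 : x != 0) (xP : not_root1 x).

Local Notation "[ n ; k ]" := (qbin x n k).
Local Notation "[[ n ; k ]]" := (qbin (x ^+ 2) n k).

Lemma coef_qserM (y y' z z' : F) (m n : int) k :
  (qser k.+1 y m z * qser k.+1 y' n z')`_k =
  \sum_(c < k.+1) qbin y m c * z ^+ c * (qbin y' n (k - c) * z' ^+ (k - c)).
Proof.
rewrite coefM; apply: eq_bigr => c _; rewrite !coef_poly ltn_ord.
by rewrite ltnS leq_subr.
Qed.

Lemma qbin_vandermonde (m p : int) k :
  \sum_(r < k.+1) [m; r] * ([p; k - r] * x ^ (- (m + p) * (k - r)%N)) =
  [m + p; k] * x ^ (- p * k%:Z).
Proof.
(* This center puts the first product at center 1, so [[m; r]] carries no power of [x]. *)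
have := qser_vandermonde x_neq0 xP m p (x ^ (- p)) (ltnSn k).
rewrite coef_qserM coef_poly ltnSn exprnP exprz_exp => ->.
apply: eq_bigr => r _; rewrite -!expfzDr // addNr expr0z expr1n mulr1.
by rewrite exprnP exprz_exp opprD (addrC (- p)).
Qed.

(* The common value of the sums over c + e = k for both parities of s. *)
Definition qmix (b : nat) (s : int) k : F :=
  \sum_(c < k.+1) [s - 1; c] * x ^ (- b%:Z * c%:Z)
    * ([[b%:Z; k - c]] * x ^ ((s + b%:Z - 2) * (k - c)%N)).

(** Vandermonde cuts the product of length b + a - 1 into [b] top and a - 1 bottom factors; the
    latter have the center x^(-b) of the other product, so [qser_double_pred] merges the two. *)
Lemma qmix_even b (a : int) k :
  \sum_(c < k.+1) x ^ (b%:Z * (c%:Z - (k - c)%N%:Z))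
    * [[b%:Z + (a - 1); c]] * [[a; k - c]] = qmix b (2 * a) k.
Proof.
have x2_neq0 := sqr_neq0 x_neq0; have x2P := not_root1_sqr xP.
pose f := qser k.+1 (x ^+ 2) (b%:Z + (a - 1)) (x ^ b)
  * qser k.+1 (x ^+ 2) a (x ^ (- b%:Z)).
pose g := qser k.+1 x (2 * a - 1) (x ^ (- b%:Z))
  * qser k.+1 (x ^+ 2) b (x ^ (2 * a + b%:Z - 2)).
have fg : eqmodXn k.+1 f g.
  apply: eqmodXn_trans (eqmodXnM (qser_vandermonde _ _ _ _ _) _) _ => //.
  rewrite -mulrA mulrC; apply: eqmodXnM.
    rewrite sqr_exprz // -expfzDr //.
    have -> : b%:Z + 2 * - b%:Z = - b%:Z by lia.
    exact: qser_double_pred.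
  rewrite sqr_exprz // -expfzDr //.
  by have -> : b%:Z + 2 * (a - 1) = 2 * a + b%:Z - 2 by lia.
have := fg k (ltnSn k); rewrite !coef_qserM => fgk.
rewrite /qmix; under [RHS]eq_bigr => c _ do rewrite -!exprz_exp -!exprnP.
rewrite -fgk; apply: eq_bigr => c _.
rewrite mulrBr (expfzDr (_ * _)) // -mulNr -!exprz_exp -!exprnP; ring.
Qed.

(** After the same cut the bottom [a] factors have center x^(-b-1) and the other product x^(-b+1),
    which is the situation of [qser_double]. *)
Lemma qmix_odd b (a : int) k :
  \sum_(c < k.+1) x ^ ((b%:Z - 1) * (c%:Z - (k - c)%N%:Z))
    * [[b%:Z + a; c]] * [[a; k - c]] = qmix b (2 * a + 1) k.
Proof.
have x2_neq0 := sqr_neq0 x_neq0; have x2P := not_root1_sqr xP.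
pose f := qser k.+1 (x ^+ 2) (b%:Z + a) (x ^ (b%:Z - 1))
  * qser k.+1 (x ^+ 2) a (x ^ (- (b%:Z - 1))).
pose g := qser k.+1 x (2 * a + 1 - 1) (x ^ (- b%:Z))
  * qser k.+1 (x ^+ 2) b (x ^ (2 * a + 1 + b%:Z - 2)).
have fg : eqmodXn k.+1 f g.
  apply: eqmodXn_trans (eqmodXnM (qser_vandermonde _ _ _ _ _) _) _ => //.
  rewrite -mulrA mulrC /g addrK; apply: eqmodXnM.
    rewrite sqr_exprz // -expfzDr //.
    have -> : b%:Z - 1 + 2 * - b%:Z = - b%:Z - 1 by lia.
    have -> : - (b%:Z - 1) = - b%:Z + 1 by lia.
    rewrite !(expfzDr (- b%:Z)) // expr1z mulrC; exact: qser_double.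
  rewrite sqr_exprz // -expfzDr //.
  by have -> : b%:Z - 1 + 2 * a = 2 * a + 1 + b%:Z - 2 by lia.
have := fg k (ltnSn k); rewrite !coef_qserM => fgk.
rewrite /qmix; under [RHS]eq_bigr => c _ do rewrite -!exprz_exp -!exprnP.
rewrite -fgk; apply: eq_bigr => c _.
rewrite mulrBr; rewrite (expfzDr (_ * _)) // -mulNr -!exprz_exp -!exprnP; ring.
Qed.

(** What the sum over [r] leaves besides a power of [x]; it involves neither [w] nor [t]. *)
Definition qmix_const (u l : nat) : F :=
  \sum_(e < u.+1) (-1) ^+ (u - e) * [[(l + u)%N%:Z; e]]
    * [l%:Z + (u - e)%N%:Z; u - e]
    * x ^ ((u%:Z - l%:Z - 2) * e%:Z - e%:Z * (u - e)%N%:Z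
           - (2 * l%:Z + (u - e)%N%:Z) * (u - e)%N%:Z).

Lemma qmix_sum u l (n : int) :
  \sum_(r < u.+1) (-1) ^+ r * [n - l%:Z; r]
    * qmix (l + u) (n - r%:Z - 2 * l%:Z) (u - r)
  = x ^ (n * u%:Z) * qmix_const u l.
Proof.
set b := (l + u)%N.
pose f r e := (-1) ^+ r * [n - l%:Z; r] *
  ([n - r%:Z - 2 * l%:Z - 1; u - e - r] * x ^ (- b%:Z * (u - e - r)%N%:Z)
   * ([[b%:Z; e]] * x ^ ((n - r%:Z - 2 * l%:Z + b%:Z - 2) * e%:Z))).
transitivity (\sum_(r < u.+1) \sum_(e < (u - r).+1) f r e).
  apply: eq_bigr => r _; rewrite /qmix mulr_sumr (reindex_inj rev_ord_inj) /=.
  apply: eq_bigr => e _; rewrite /f subSS subKn -1?ltnS //.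
  by rewrite subnAC.
rewrite exchange_big_triangle mulr_sumr; apply: eq_bigr => e _.
have eu : (e <= u)%N by rewrite -ltnS.
set M := (u - e)%N; have defu : u%:Z = M%:Z + e%:Z by lia.
(* [p] is the upper entry produced by [qbinN]. It is free of [r], and n - l + p = l + M is free of
   [n]. *)
pose p := 2 * l%:Z + M%:Z - n.
pose K := (-1) ^+ M * [[b%:Z; e]]
  * x ^ ((n - 2 * l%:Z + b%:Z - 2) * e%:Z - e%:Z * M%:Z).
transitivity (K * ([n - l%:Z + p; M] * x ^ (- p * M%:Z))).
  rewrite -qbin_vandermonde mulr_sumr; apply: eq_bigr => r _.
  have rM : (r <= M)%N by rewrite -ltnS.
  rewrite /f -/M [X in _ * (X * _ * _)]qbinN.
  have -> : (M - r)%N%:Z - 1 - (n - r%:Z - 2 * l%:Z - 1) = p by rewrite /p; lia.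
  rewrite /K; have -> : (-1) ^+ M = (-1) ^+ r * (-1) ^+ (M - r) :> F.
    by rewrite -exprD subnKC.
  set e1 := - b%:Z * _; set e2 := _ * e%:Z.
  set e3 := _ - _ * M%:Z; set e4 := - _ * _.
  have : x ^ e1 * x ^ e2 = x ^ e3 * x ^ e4.
    by rewrite -!expfzDr //; congr (x ^ _); rewrite /e1 /e2 /e3 /e4 /p /b; nia.
  by move: (x ^ e1) (x ^ e2) (x ^ e3) (x ^ e4) => y1 y2 y3 y4 y12; ring: y12.
have -> : n - l%:Z + p = l%:Z + M%:Z by rewrite /p; lia.
rewrite /K; set e1 := _ - _ * M%:Z; set e2 := - p * _; set e3 := n * _.
set e4 := _ - _.
have : x ^ e1 * x ^ e2 = x ^ e3 * x ^ e4.
  by rewrite -!expfzDr //; congr (x ^ _); rewrite /e1 /e2 /e3 /e4 /p /b; nia.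
by move: (x ^ e1) (x ^ e2) (x ^ e3) (x ^ e4) => y1 y2 y3 y4 y12; ring: y12.
Qed.

Lemma qmix_const0 u : (0 < u)%N -> qmix_const u 0 = 0.
Proof.
move=> u_gt0.
have x2_neq0 := sqr_neq0 x_neq0; have x2P := not_root1_sqr xP.
have x2V_neq0 : (x ^+ 2)^-1 != 0 by rewrite invr_eq0.
have := alternating_qbin_sum x2V_neq0 (not_root1V x2P) u_gt0.
(* At [l = 0] the exponent in [qmix_const] is -u^2 + 2 e (u - 1); the base x^(-2) in the alternating
   sum accounts for the second term. *)
move/(congr1 ( *%R ((-1) ^+ u * x ^ (- u%:Z * u%:Z)))).
rewrite mulr0 => <-; rewrite mulr_sumr; apply: eq_bigr => e _.
have eu : (e <= u)%N by rewrite -ltnS.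
rewrite qbinV !add0r qbin_nn // mulr1 exprz_inv sqr_exprz // add0n.
have sgn : (-1) ^+ (u - e) = (-1) ^+ u * (-1) ^+ e :> F.
  by rewrite -exprD -signr_odd -[RHS]signr_odd oddB // oddD.
rewrite sgn; set e1 := _ - _; set e2 := - _ * _; set e3 := 2 * _.
have -> : e1 = e2 + e3 by rewrite /e1 /e2 /e3; nia.
by rewrite expfzDr //; ring.
Qed.

Lemma alternating_qmix_sum w u l : (0 < u + l)%N ->
  \sum_(t < l.+1) (-1) ^+ t * x ^ (- t%:Z * (l%:Z + u%:Z - 1)) * [l%:Z; t]
    * (\sum_(r < u.+1) (-1) ^+ r * [w + t%:Z - l%:Z; r]
        * qmix (l + u) (w + t%:Z - r%:Z - 2 * l%:Z) (u - r)) = 0.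
Proof.
move=> ul; under eq_bigr => t _ do rewrite qmix_sum.
case: l ul => [|l] ul.
  by rewrite big_ord1 qmix_const0 ?mulr0 // -(addn0 u).
have := alternating_qbin_sum x_neq0 xP (ltn0Sn l).
move/(congr1 ( *%R (x ^ (w * u%:Z) * qmix_const u l.+1))).
rewrite mulr0 => sum0.
rewrite -[RHS]sum0 mulr_sumr; apply: eq_bigr => t _.
(* The factor x^(t u) turns the exponent -t (l + u - 1) into -t (l - 1). *)
have -> : (w + t%:Z) * u%:Z = w * u%:Z + t%:Z * u%:Z by ring.
set e1 := - _ * _; set e2 := - _ * _; have -> : e2 = e1 + t%:Z * u%:Z.
  by rewrite /e1 /e2; ring.
by rewrite !expfzDr //; ring.
Qed.

Definition even_term (w : int) (u l c e r t : nat) : F :=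
  x ^ (- t%:Z * (l%:Z + u%:Z - 1) + (l%:Z + u%:Z) * (c%:Z - e%:Z))
  * [l%:Z; t] * [w + t%:Z - l%:Z; r]
  * [[u%:Z - 1 + ((w + t%:Z - r%:Z) %/ 2)%Z; c]]
  * [[((w + t%:Z - r%:Z) %/ 2)%Z - l%:Z; e]].

Definition odd_term (w : int) (u l c e r t : nat) : F :=
  x ^ (- t%:Z * (l%:Z + u%:Z - 1) + (l%:Z + u%:Z - 1) * (c%:Z - e%:Z))
  * [l%:Z; t] * [w + t%:Z - l%:Z; r]
  * [[u%:Z + ((w + t%:Z - r%:Z - 1) %/ 2)%Z; c]]
  * [[((w + t%:Z - r%:Z - 1) %/ 2)%Z - l%:Z; e]].

Lemma sign_parity (w : int) (t r : nat) :
  (-1) ^ w * (-1) ^+ t * (-1) ^+ r =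
  (if (2 %| t%:Z + w - r%:Z)%Z then 1 else -1) :> F.
Proof.
have N1 : (-1 : F) != 0 by rewrite oppr_eq0 oner_eq0.
rewrite !exprnP -!expfzDr //.
have sqr m : (-1 : F) ^ (2 * m) = 1.
  by rewrite -exprz_exp -exprnP sqrrN expr1n exp1rz.
case: ifPn => par.
  have -> : w + t%:Z + r%:Z = 2 * ((t%:Z + w - r%:Z) %/ 2)%Z + 2 * r%:Z by lia.
  by rewrite expfzDr // !sqr mulr1.
have -> : w + t%:Z + r%:Z
    = 2 * ((t%:Z + w - r%:Z) %/ 2)%Z + 2 * r%:Z + 1 by lia.
by rewrite !expfzDr // !sqr !mul1r expr1z.
Qed.

(** The sign is (-1)^(w+t-r), so the difference of the even and odd sums becomes one sum without a
    parity condition. *)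
Definition mixed_term (w : int) (u l r t : nat) : F :=
  (-1) ^ w * (-1) ^+ t * (-1) ^+ r *
  (x ^ (- t%:Z * (l%:Z + u%:Z - 1)) * [l%:Z; t] * [w + t%:Z - l%:Z; r]
   * qmix (l + u) (w + t%:Z - r%:Z - 2 * l%:Z) (u - r)).

Lemma sum_even_term w u l r t : (2 %| t%:Z + w - r%:Z)%Z ->
  \sum_(c < (u - r).+1) even_term w u l c (u - r - c) r t
  = mixed_term w u l r t.
Proof.
move=> par; rewrite /mixed_term sign_parity par mul1r /even_term.
set k := ((w + t%:Z - r%:Z) %/ 2)%Z.
have defk : w + t%:Z - r%:Z - 2 * l%:Z = 2 * (k - l%:Z) by rewrite /k; lia.
rewrite defk -qmix_even mulr_sumr; apply: eq_bigr => c _.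
have -> : (l + u)%N%:Z + (k - l%:Z - 1) = u%:Z - 1 + k by lia.
by rewrite expfzDr // PoszD; ring.
Qed.

Lemma sum_odd_term w u l r t : ~~ (2 %| t%:Z + w - r%:Z)%Z ->
  \sum_(c < (u - r).+1) odd_term w u l c (u - r - c) r t
  = - mixed_term w u l r t.
Proof.
move=> par; rewrite /mixed_term sign_parity (negPf par) mulN1r opprK /odd_term.
set k := ((w + t%:Z - r%:Z - 1) %/ 2)%Z.
have defk : w + t%:Z - r%:Z - 2 * l%:Z = 2 * (k - l%:Z) + 1 by rewrite /k; lia.
rewrite defk -qmix_odd mulr_sumr; apply: eq_bigr => c _.
have -> : (l + u)%N%:Z + (k - l%:Z) = u%:Z + k by lia.
by rewrite expfzDr // PoszD; ring.
Qed.

Lemma parity_sum_eq0 (w : int) (u l : nat) : (0 < u + l)%N ->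
  \sum_(c < u.+1) \sum_(e < u.+1) \sum_(r < u.+1 | (c + e + r == u)%N)
    \sum_(t < l.+1 | (2 %| t%:Z + w - r%:Z)%Z) even_term w u l c e r t
  - \sum_(c < u.+1) \sum_(e < u.+1) \sum_(r < u.+1 | (c + e + r == u)%N)
    \sum_(t < l.+1 | ~~ (2 %| t%:Z + w - r%:Z)%Z) odd_term w u l c e r t = 0.
Proof.
move=> ul.
rewrite (big_simplex u (fun c e r =>
  \sum_(t < l.+1 | (2 %| t%:Z + w - r%:Z)%Z) even_term w u l c e r t)).
rewrite (big_simplex u (fun c e r =>
  \sum_(t < l.+1 | ~~ (2 %| t%:Z + w - r%:Z)%Z) odd_term w u l c e r t)).
rewrite -sumrB -[RHS](mulr0 ((-1) ^ w)).
rewrite -[X in _ = _ * X](alternating_qmix_sum w ul).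
transitivity (\sum_(r < u.+1) \sum_(t < l.+1) mixed_term w u l r t).
  apply: eq_bigr => r _; rewrite exchange_big /= [X in _ - X]exchange_big /=.
  rewrite [RHS](bigID (fun t : 'I__ => (2 %| t%:Z + w - r%:Z)%Z)) /=.
  congr (_ + _); first by apply: eq_bigr => t; apply: sum_even_term.
  rewrite -sumrN; apply: eq_bigr => t par.
  by rewrite sum_odd_term ?opprK.
rewrite exchange_big mulr_sumr; apply: eq_bigr => t _.
rewrite !mulr_sumr; apply: eq_bigr => r _; rewrite /mixed_term; ring.
Qed.

End MainIdentity.

Lemma tofracX_not_root1 (R : idomainType) :
  not_root1 (FracField.tofrac ('X : {poly R})).
Proof.
move=> i i_gt0; rewrite -rmorphXn /= -(rmorph1 (@FracField.tofrac {poly R})).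
rewrite tofrac_eq; apply/eqP => /(congr1 (fun f : {poly R} => size f)).
by rewrite size_polyXn size_poly1 => -[i0]; rewrite i0 in i_gt0.
Qed.

Theorem theorem3p6 (w : int) (u l : nat) :
  ~ (u = 0%N /\ l = 0%N) -> T w u l = 0.
Proof.
(* T unfolds to the two sums of parity_sum_eq0. *)
move=> ul; apply: (@parity_sum_eq0 Qq q) => //.
- by rewrite tofrac_eq0 polyX_eq0.
- exact: tofracX_not_root1.
- by rewrite lt0n addn_eq0; apply/andP => -[/eqP u0 /eqP l0]; apply: ul.
Qed.
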